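(* For each positive integer $n$, let $H_n$ denote the set of HKZ reduced bases $B=\{\mathbf{b}_1,\dots,\mathbf{b}_n\}$ of rank-$n$ lattices (in any $\mathbb{R}^m$, $m\ge n$), and set $\Delta_n=\max_{B\in H_n}\Delta(B)$. Then $\Delta_1=1$, $\Delta_2=\frac{4}{3}$ and $\Delta_3=\frac{25}{12}$ (in particular, for $n\le 3$ the supremum of $\Delta$ over $H_n$ is attained).
   Context: For linearly independent vectors $\mathbf{b}_1,\dots,\mathbf{b}_n\in\mathbb{R}^m$, define the Gram–Schmidt data recursively by $\mathbf{b}_1(1)=\mathbf{b}_1$, $\mu_{i,j}=\frac{\langle \mathbf{b}_i,\mathbf{b}_j(j)\rangle}{\|\mathbf{b}_j(j)\|^2}$ for $1\le j<i\le n$, and $\mathbf{b}_i(j)=\mathbf{b}_i-\sum_{k=1}^{j-1}\mu_{i,k}\mathbf{b}_k(k)$ for $1\le j\le i\le n$ (so $\mathbf{b}_i(j)$ is the projection of $\mathbf{b}_i$ orthogonally to $\mathbf{b}_1,\dots,\mathbf{b}_{j-1}$). The basis $B=\{\mathbf{b}_1,\dots,\mathbf{b}_n\}$ of the lattice $\Lambda(B)=\{\sum_i x_i\mathbf{b}_i: x_i\in\mathbb{Z}\}$ is HKZ (Hermite–Korkine–Zolotarev) reduced if (i) $|\mu_{i,j}|\le 1/2$ for all $1\le j<i\le n$, (ii) $\mathbf{b}_1$ is a shortest nonzero vector of $\Lambda(B)$, and (iii) $\{\mathbf{b}_2(2),\dots,\mathbf{b}_n(2)\}$ is HKZ reduced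 (recursively; a one-element basis consisting of a nonzero vector satisfies the definition via (ii)). The orthogonality defect is $\Delta(B)=\frac{\prod_{i=1}^n\|\mathbf{b}_i\|^2}{\det(B)^2}$, where $\det(B)^2=\prod_{i=1}^n\|\mathbf{b}_i(i)\|^2$ is the Gram determinant of the basis. *)

(* Defs.v *)
From mathcomp Require Import all_boot all_order all_algebra.
From mathcomp Require Import boolp classical_sets reals.
Set Implicit Arguments. Unset Strict Implicit. Unset Printing Implicit Defensive.
Import Order.TTheory GRing.Theory Num.Theory.
Local Open Scope classical_set_scope.
Local Open Scope ring_scope.

Section Lattices.
Variables (R : realType) (m : nat).
Local Notation V := 'rV[R]_m.

Definition dot (u v : V) : R := \sum_(k < m) u 0 k * v 0 k.

Definition enorm (u : V) : R := Num.sqrt (dot u u).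

Definition gs_coef (u v : V) : R := dot u v / enorm v ^+ 2.

(* Indices start at 0: [gs_proj b j i] (for j <= i) is the vector b_{i+1}(j+1)
   of the 1-based literature, i.e. b_i projected orthogonally to
   b_0, ..., b_{j-1}.  The defining sum is peeled off one term at a time so that
   the recursion is structural; see [gs_projE] for the closed form. *)
Fixpoint gs_proj (b : seq V) (j i : nat) : V :=
  if j is k.+1 then
    gs_proj b k i - gs_coef b`_i (gs_proj b k k) *: gs_proj b k k
  else b`_i.

Definition gs_mu (b : seq V) (i j : nat) : R := gs_coef b`_i (gs_proj b j j).

Lemma gs_projE (b : seq V) (j i : nat) :
  gs_proj b j i = b`_i - \sum_(k < j) gs_mu b i k *: gs_proj b k k.
Proof.
elim: j => [|j IHj]; first by rewrite big_ord0 subr0.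
by rewrite big_ord_recr /= IHj opprD addrA.
Qed.

Definition lattice n (B : n.-tuple V) : set V :=
  [set v | exists x : 'I_n -> int, v = \sum_(i < n) (x i)%:~R *: tnth B i].

Definition shortest_nonzero (L : set V) (v : V) : Prop :=
  [/\ L v, v != 0 & forall w, L w -> w != 0 -> enorm v <= enorm w].

(* The empty tuple is only the base case of the recursion: a one-element tuple
   is reduced exactly when its entry is nonzero. *)
Fixpoint HKZ_reduced n : n.-tuple V -> Prop :=
  match n return n.-tuple V -> Prop with
  | 0 => fun=> True
  | n'.+1 => fun B =>
    [/\ forall i j : 'I_n'.+1, (j < i)%N -> `|gs_mu B i j| <= 1 / 2,
        shortest_nonzero (lattice B) (thead B)
      & HKZ_reduced [tuple gs_proj B 1 i.+1 | i < n']]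
  end.

Definition det2 n (B : n.-tuple V) : R :=
  \prod_(i < n) enorm (gs_proj B i i) ^+ 2.

Definition orth_defect n (B : n.-tuple V) : R :=
  (\prod_(i < n) enorm (tnth B i) ^+ 2) / det2 B.

Lemma dotC u v : dot u v = dot v u.
Proof. by apply: eq_bigr => k _; rewrite mulrC. Qed.

Lemma dotBZl a u v w : dot (u - a *: v) w = dot u w - a * dot v w.
Proof.
rewrite /dot mulr_sumr -sumrB; apply: eq_bigr => k _.
by rewrite !mxE mulrBl mulrA.
Qed.

Lemma enorm_sqr u : enorm u ^+ 2 = dot u u.
Proof. by rewrite sqr_sqrtr // sumr_ge0 // => k _; rewrite -expr2 sqr_ge0. Qed.

Lemma gs_coefK u v : gs_coef u v * dot v v = dot u v.
Proof.
rewrite /gs_coef enorm_sqr; have [v0|/mulfVK-> //] := eqVneq (dot v v) 0.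
rewrite v0 mulr0 /dot big1 // => k _.
have /eqP : v 0 k * v 0 k = 0.
  by apply: (psumr_eq0P _ v0) => // i _; rewrite -expr2 sqr_ge0.
by rewrite mulf_eq0 orbb => /eqP->; rewrite mulr0.
Qed.

Lemma dot_gs_proj (b : seq V) (j k i : nat) :
  (k < j)%N -> dot (gs_proj b j i) (gs_proj b k k) = 0.
Proof.
elim: j k i => // j IHj k i; rewrite ltnS leq_eqVlt /= dotBZl.
case/predU1P=> [->|lt_kj]; last by rewrite !IHj // mulr0 subr0.
suff -> : dot (gs_proj b j i) (gs_proj b j j) = dot b`_i (gs_proj b j j).
  by rewrite gs_coefK subrr.
have: (j <= j)%N by [].
elim: {1 3}j => // l IHl lt_lj; rewrite /= dotBZl IHl 1?ltnW //.
by rewrite (dotC (gs_proj b l l)) IHj // mulr0 subr0.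
Qed.

Lemma det2_gram n (B : n.-tuple V) :
  det2 B = \det (\matrix_(i < n, j < n) dot (tnth B i) (tnth B j)).
Proof.
pose L : 'M[R]_n := \matrix_(i, j)
  if (j < i)%N then gs_mu B i j else (i == j)%:R.
pose G : 'M[R]_(n, m) := \matrix_(i < n) gs_proj B i i.
pose A : 'M[R]_(n, m) := \matrix_(i < n) tnth B i.
have dotE u v : dot u v = (u *m v^T) 0 0.
  by rewrite mxE; apply: eq_bigr => k _; rewrite mxE.
have mulE p (M N : 'M[R]_(p, m)) :
    M *m N^T = \matrix_(i, j) dot (row i M) (row j N).
  by apply/matrixP => i j; rewrite !mxE; apply: eq_bigr => k _; rewrite !mxE.
have -> : \matrix_(i < n, j < n) dot (tnth B i) (tnth B j) = A *m A^T.
  by rewrite mulE; apply/matrixP => i j; rewrite !mxE !rowK.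
have AE : A = L *m G.
  apply/row_matrixP => i; rewrite rowK row_mul mulmx_sum_row.
  rewrite (bigID (fun j : 'I_n => (j < i)%N)) /= addrC.
  rewrite (bigD1 i) ?ltnn //= big1 ?addr0 => [|j /andP[]]; last first.
    rewrite -leqNgt => le_ij /negPf ne_ji; rewrite !mxE ltnNge le_ij /=.
    by rewrite eq_sym ne_ji scale0r.
  rewrite !mxE ltnn eqxx scale1r rowK gs_projE -tnth_nth.
  rewrite (big_ord_widen _ (fun k => gs_mu B i k *: gs_proj B k k) (ltnW (ltn_ord i))).
  rewrite [X in _ + X](eq_bigr (fun j : 'I_n => gs_mu B i j *: gs_proj B j j)).
    by rewrite subrK.
  by move=> j lt_ji; rewrite !mxE lt_ji rowK.
have detL : \det L = 1.
  rewrite det_trig; first by rewrite big1 // => i _; rewrite mxE ltnn eqxx.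
  apply/is_trig_mxP => i j lt_ij; rewrite mxE ltnNge ltnW //=.
  by rewrite -val_eqE /= ltn_eqF.
have GE : G *m G^T = diag_mx (\row_i (enorm (gs_proj B i i) ^+ 2)).
  rewrite mulE; apply/matrixP => i j; rewrite !mxE !rowK.
  have [<-|ne_ij] := eqVneq i j; first by rewrite enorm_sqr.
  rewrite mulr0n; case: (ltngtP i j) => [lt|gt|/val_inj eq_ij].
  - by rewrite dotC dot_gs_proj.
  - by rewrite dot_gs_proj.
  - by rewrite eq_ij eqxx in ne_ij.
rewrite AE trmx_mul mulmxA -(mulmxA L) !det_mulmx det_tr detL mul1r mulr1.
by rewrite GE det_diag; apply: eq_bigr => i _; rewrite mxE.
Qed.

End Lattices.

Definition HKZ_defects (R : realType) (n : nat) : set R :=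
  [set d | exists (m : nat) (B : n.-tuple 'rV[R]_m),
     [/\ (n <= m)%N, free B, HKZ_reduced B & d = orth_defect B]].
Arguments HKZ_defects : clear implicits.

Definition is_max (R : realType) (A : set R) (x : R) : Prop :=
  A x /\ ubound A x.

(* Main.v *)
(* Write x, y, z for mu_21, mu_31, mu_32 and normalize |b_1|^2 = 1,
   s = |b_2(2)|^2, t = |b_3(3)|^2.  Since |b_1| is minimal in the lattice and
   |b_2(2)| in the projected lattice,
     1 <= s + x^2,   s <= t + z^2 s,
     1 <= t + (1 - |z|)^2 s + (1 - |x| - |y|)^2,
   where the last bound comes from a vector b_3 + q b_2 + p b_1 with q = +-1 of
   sign opposite to z and suitable p in {-1, 0, 1}.  These three inequalities
   and the bounds 1/2 on |x|, |y|, |z| imply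
     (s + x^2)(t + z^2 s + y^2) <= (25/12) s t.
   Equality holds for x = y = z = 1/2, s = 1, t = 3/4; scaled by 4, this is
   realized by orthogonal vectors of squared norms 4, 4, 3, and the last two of
   them give the hexagonal lattice, which is extremal in rank 2. *)
Require Import Defs.
From mathcomp Require Import all_boot all_order all_algebra.
From mathcomp Require Import boolp classical_sets reals.
From mathcomp Require Import ring lra zify.
Import Order.TTheory GRing.Theory Num.Theory.
Local Open Scope ring_scope.

(** * Polynomial inequalities in the Gram-Schmidt parameters *)

(** A concave function lies above its chord. The bounds below use this to eliminate one variable at
    a time by checking two endpoints. *)
Lemma concave_quadratic_ge0 (R : realFieldType) (a b c l u s : R) :
  0 <= a -> l <= s <= u -> 0 <= c + b * l - a * l ^+ 2 ->
  0 <= c + b * u - a * u ^+ 2 -> 0 <= c + b * s - a * s ^+ 2.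
Proof.
move=> a0 /andP[ls su] fl fu.
have [ul|] := ltP l u; last first.
  by move=> ul; have -> : s = l by lra.
have ul0 : 0 < u - l by lra.
rewrite -(pmulr_rge0 _ ul0).
have -> : (u - l) * (c + b * s - a * s ^+ 2) =
  (u - s) * (c + b * l - a * l ^+ 2) + (s - l) * (c + b * u - a * u ^+ 2)
  + a * (u - l) * ((s - l) * (u - s)) by ring.
by rewrite !addr_ge0 ?mulr_ge0 // subr_ge0 // ltW.
Qed.

(** By AM-GM the product [(s + x ^+ 2) * (s + w ^+ 2)] is at most the square of
    [s + (x ^+ 2 + w ^+ 2) / 2], which is at most [5 / 4 * s]. *)
Lemma projection_bound (R : realFieldType) (x w s : R) :
  2 * (x ^+ 2 + w ^+ 2) <= s ->
  16 * (s + x ^+ 2) * (s + w ^+ 2) <= 25 * s ^+ 2.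
Proof.
move=> h.
have x0 := sqr_ge0 x; have w0 := sqr_ge0 w.
have := sqr_ge0 (x ^+ 2 - w ^+ 2).
set X := x ^+ 2 in h x0 *; set W := w ^+ 2 in h w0 *.
move=> xw; nra.
Qed.

(** As [x] and [w] are at most [1 / 2], the left side is at most [x + w]; the right side equals
    [(x + w) * (2 - (x + w))], and [x + w <= 1]. *)
Lemma sqr_sum_bound (R : realFieldType) (x w : R) :
  0 <= x <= 1 / 2 -> 0 <= w <= 1 / 2 ->
  2 * (x ^+ 2 + w ^+ 2) <= 1 - (1 - x - w) ^+ 2.
Proof.
move=> /andP[x0 x1] /andP[w0 w1].
have h1 : 0 <= x * (1 / 2 - x) by rewrite mulr_ge0 // subr_ge0.
have h2 : 0 <= w * (1 / 2 - w) by rewrite mulr_ge0 // subr_ge0.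
have h3 : 0 <= (x + w) * (1 - (x + w)) by rewrite mulr_ge0 //; lra.
nra.
Qed.

(* [normalized_bound] at [z = 1 / 2], with [t] equal to its third lower bound. *)
Lemma half_bound (R : realFieldType) (x w s D : R) :
  0 <= x <= 1 / 2 -> 0 <= w <= 1 / 2 -> D = 1 - (1 - x - w) ^+ 2 ->
  1 - x ^+ 2 <= s -> s <= D ->
  12 * (s + x ^+ 2) * (s / 4 + w ^+ 2) <= (D - s / 4) * (13 * s - 12 * x ^+ 2).
Proof.
move=> x01 w01 DE sx sD.
have /projection_bound hD := sqr_sum_bound _ _ _ x01 w01.
rewrite -DE in hD; move: x01 w01 => /andP[x0 x1] /andP[w0 w1].
(* Combining [1 - x ^+ 2 <= s] and [s <= D] gives [(1 - x - w) ^+ 2 <= x ^+ 2]. *)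
have wx : 1 - 2 * x <= w by nra.
rewrite -subr_ge0.
suff : 0 <= (- 12 * x ^+ 2 * (D + w ^+ 2)) + (13 * D - 12 * w ^+ 2) * s
    - 25 / 4 * s ^+ 2.
  by congr (_ <= _); field.
apply: (@concave_quadratic_ge0 _ _ _ _ (1 - x ^+ 2) D); rewrite ?sx //.
- lra.
(* At [s = 1 - x ^+ 2] the expression is a concave quadratic in [w]. Its left endpoint
   [w = 1 - 2 * x] has [D = s], so [projection_bound] applies there. *)
- suff : 0 <= ((1 - (1 - x) ^+ 2) * (13 - 25 * x ^+ 2)
       - 25 / 4 * (1 - x ^+ 2) ^+ 2)
     + (2 * (1 - x) * (13 - 25 * x ^+ 2)) * w - (25 - 25 * x ^+ 2) * w ^+ 2.
    by congr (_ <= _); rewrite DE; field.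
  apply: (@concave_quadratic_ge0 _ _ _ _ (1 - 2 * x) (1 / 2)).
  + nra.
  + rewrite wx; lra.
  + have := @projection_bound R x (1 - 2 * x) (1 - x ^+ 2).
    nra.
  + nra.
(* At [s = D] the claim amounts to [hD]. *)
- nra.
Qed.

(* [normalized_bound] where both lower bounds for [t] agree:
   [z = 1 - D / (2 * s)] and [t = s * (1 - z ^+ 2)]. *)
Lemma corner_bound (R : realFieldType) (x w s D : R) :
  0 <= x <= 1 / 2 -> 0 <= w <= 1 / 2 -> D = 1 - (1 - x - w) ^+ 2 ->
  1 - x ^+ 2 <= s -> s <= D ->
  12 * (s + x ^+ 2) * (s + w ^+ 2) <= 25 * D * (s - D / 4).
Proof.
move=> x01 w01 DE sx sD.
have /projection_bound hD := sqr_sum_bound _ _ _ x01 w01.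
rewrite -DE in hD; move: x01 w01 => /andP[x0 x1] /andP[w0 w1].
have wx : 1 - 2 * x <= w by nra.
rewrite -subr_ge0.
suff : 0 <= (- 25 * D ^+ 2 / 4 - 12 * x ^+ 2 * w ^+ 2)
    + (25 * D - 12 * (x ^+ 2 + w ^+ 2)) * s - 12 * s ^+ 2.
  by congr (_ <= _); field.
apply: (@concave_quadratic_ge0 _ _ _ _ (1 - x ^+ 2) D); rewrite ?sx //.
- (* [D] is concave in [w], hence above its chord [E] on [1 - 2x, 1/2]. *)
  pose E := 1 - (1 - x - w) / 2 + x / 2 - x ^+ 2.
  have ED : E <= D by rewrite /E DE; nra.
  have D1 : D <= 1 by rewrite DE; nra.
  (* [D * (s - D / 4)] increases in [D] up to [2 * s], and [D <= 1 <= 2 * (1 - x ^+ 2)], so [D] may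
     be lowered to [E]. This turns a quartic in [w] into a concave quadratic. *)
  have : 0 <= 25 * E * (1 - x ^+ 2 - E / 4) - 12 * (1 - x ^+ 2 + w ^+ 2).
    suff : 0 <= (25 * (1 / 2 + x - x ^+ 2) * (7 / 8 - x / 4 - 3 / 4 * x ^+ 2)
        - 12 * (1 - x ^+ 2))
      + 25 * (((7 / 8 - x / 4 - 3 / 4 * x ^+ 2) - (1 / 2 + x - x ^+ 2) / 4) / 2)
        * w - (217 / 16) * w ^+ 2.
      by congr (_ <= _); rewrite /E; field.
    apply: (@concave_quadratic_ge0 _ _ _ _ (1 - 2 * x) (1 / 2)).
    + lra.
    + rewrite wx; lra.
    + nra.
    + nra.
  nra.
- nra.
Qed.

(** The coefficient of [t] in right side minus left side is [13 * s - 12 * x ^+ 2 >= 0], so [t] may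
    be replaced by either of its lower bounds [s * (1 - z ^+ 2)] and [D - (1 - z) ^+ 2 * s]. The
    first is the larger one exactly when [z * s <= s - D / 2]. *)
Lemma normalized_bound (R : realFieldType) (x w z s t : R) :
  0 <= x <= 1 / 2 -> 0 <= w <= 1 / 2 -> 0 <= z <= 1 / 2 ->
  1 <= s + x ^+ 2 -> s <= t + z ^+ 2 * s ->
  1 <= t + (1 - z) ^+ 2 * s + (1 - x - w) ^+ 2 ->
  12 * (s + x ^+ 2) * (t + z ^+ 2 * s + w ^+ 2) <= 25 * s * t.
Proof.
move=> x01 w01 z01 sx st t4.
have hD := sqr_sum_bound _ _ _ x01 w01.
have [D DE] : {D | D = 1 - (1 - x - w) ^+ 2} by exists (1 - (1 - x - w) ^+ 2).
have /andP[x0 x1] := x01; have /andP[w0 w1] := w01; have /andP[z0 z1] := z01.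
have x2 : x ^+ 2 <= 1 / 4 by nra.
have z2 : z ^+ 2 <= 1 / 4 by nra.
have s34 : 3 / 4 <= s by lra.
have k0 : 0 <= 13 * s - 12 * x ^+ 2 by lra.
have t2_suff : 12 * (s + x ^+ 2) * (s + w ^+ 2) <= 25 * s ^+ 2 * (1 - z ^+ 2) ->
    12 * (s + x ^+ 2) * (t + z ^+ 2 * s + w ^+ 2) <= 25 * s * t.
  have : 0 <= (t - s * (1 - z ^+ 2)) * (13 * s - 12 * x ^+ 2).
    by rewrite mulr_ge0 //; lra.
  move=> A B; nra.
(* If [D <= s], the first lower bound suffices: [z <= 1 / 2] gives [1 - z ^+ 2 >= 3 / 4], and
   [25 * 3 / 4] matches [projection_bound]. *)
have [Ds|sD] := lerP D s.
  apply: t2_suff.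
  have : 16 * (s + x ^+ 2) * (s + w ^+ 2) <= 25 * s ^+ 2.
    by apply: projection_bound; rewrite (le_trans hD) // -DE.
  have : 0 <= s ^+ 2 * (1 / 4 - z ^+ 2) by rewrite mulr_ge0 ?sqr_ge0 // subr_ge0.
  move=> A B; lra.
have sx' : 1 - x ^+ 2 <= s by lra.
have corner := corner_bound _ _ _ _ _ x01 w01 DE sx' (ltW sD).
have half := half_bound _ _ _ _ _ x01 w01 DE sx' (ltW sD).
have D1 : D <= 1 by rewrite DE; have := sqr_ge0 (1 - x - w); lra.
(* Beyond the crossing point of the two lower bounds for [t], the claim for
   [t = D - (1 - z) ^+ 2 * s] is concave in [z]. *)
have [zD|Dz] := lerP (z * s) (s - D / 2).
  apply: t2_suff.
  (* This says [s ^+ 2 * (1 - z ^+ 2) >= D * (s - D / 4)], which reduces the goal to [corner]. *)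
  have : 0 <= (s - D / 2 - z * s) * (s - D / 2 + z * s).
    by rewrite mulr_ge0 //; nra.
  move=> A; nra.
have s0 : s != 0 by rewrite gt_eqF //; lra.
suff G : 0 <= ((D - s) * (13 * s - 12 * x ^+ 2) - 12 * (s + x ^+ 2) * w ^+ 2)
    + 2 * s * (13 * s - 12 * x ^+ 2) * z - 25 * s ^+ 2 * z ^+ 2.
  have : 0 <= (t - (D - (1 - z) ^+ 2 * s)) * (13 * s - 12 * x ^+ 2).
    by rewrite mulr_ge0 //; lra.
  nra.
apply: (@concave_quadratic_ge0 _ _ _ _ (1 - D / (2 * s)) (1 / 2)).
- by rewrite mulr_ge0 ?sqr_ge0 //; lra.
- rewrite z1 andbT -(ler_pM2r (_ : 0 < s)); last lra.
  have -> : (1 - D / (2 * s)) * s = s - D / 2 by field.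
  lra.
- have -> : (D - s) * (13 * s - 12 * x ^+ 2) - 12 * (s + x ^+ 2) * w ^+ 2 +
    2 * s * (13 * s - 12 * x ^+ 2) * (1 - D / (2 * s)) -
    25 * s ^+ 2 * (1 - D / (2 * s)) ^+ 2 =
    25 * D * (s - D / 4) - 12 * (s + x ^+ 2) * (s + w ^+ 2) by field.
  by rewrite subr_ge0.
- nra.
Qed.

(** Here [a], [b], [c] stand for the squared norms of the three Gram-Schmidt vectors. Choosing [p]
    and [q] by the signs of [x], [y], [z] and dividing by [a] leads to [normalized_bound]. *)
Lemma rank3_bound (R : realFieldType) (x y z a b c : R) :
  0 < a -> `|x| <= 1 / 2 -> `|y| <= 1 / 2 -> `|z| <= 1 / 2 ->
  a <= x ^+ 2 * a + b -> b <= z ^+ 2 * b + c ->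
  (forall p q : int,
    a <= (y + q%:~R * x + p%:~R) ^+ 2 * a + (z + q%:~R) ^+ 2 * b + c) ->
  12 * (b + x ^+ 2 * a) * (c + z ^+ 2 * b + y ^+ 2 * a) <= 25 * b * c.
Proof.
move=> a0 x1 y1 z1 ab bc abc.
have key : a <= c + (1 - `|z|) ^+ 2 * b + (1 - `|x| - `|y|) ^+ 2 * a.
  (* Take [q] of sign opposite to [z]. If [y] and [q * x] have opposite signs, [p = 0] works because
     [|x|] and [|y|] are at most [1 / 2]; if they have the same sign, [p] of the other sign gives
     equality of the squares. *)
  have abc' p q : (y + q%:~R * x + p%:~R) ^+ 2 <= (1 - `|x| - `|y|) ^+ 2 ->
      (z + q%:~R) ^+ 2 = (1 - `|z|) ^+ 2 ->
      a <= c + (1 - `|z|) ^+ 2 * b + (1 - `|x| - `|y|) ^+ 2 * a.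
    move=> h <-; have := abc p q; move: h; rewrite -(ler_pM2r a0); lra.
  move: x1 y1 z1 abc' {abc}.
  case: (ger0P z) => z0; case: (ger0P x) => x0; case: (ger0P y) => y0;
    move=> x1 y1 z1 abc.
  + by apply: (abc 0 (-1)); rewrite ?mulrNz ?mulr0z ?mulr1z; nra.
  + by apply: (abc 1 (-1)); rewrite ?mulrNz ?mulr0z ?mulr1z; nra.
  + by apply: (abc (-1) (-1)); rewrite ?mulrNz ?mulr0z ?mulr1z; nra.
  + by apply: (abc 0 (-1)); rewrite ?mulrNz ?mulr0z ?mulr1z; nra.
  + by apply: (abc (-1) 1); rewrite ?mulrNz ?mulr0z ?mulr1z; nra.
  + by apply: (abc 0 1); rewrite ?mulrNz ?mulr0z ?mulr1z; nra.
  + by apply: (abc 0 1); rewrite ?mulrNz ?mulr0z ?mulr1z; nra.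
  + by apply: (abc 1 1); rewrite ?mulrNz ?mulr0z ?mulr1z; nra.
have an0 : a != 0 by rewrite gt_eqF.
have bE : b = b / a * a by rewrite divfK.
have cE : c = c / a * a by rewrite divfK.
have := @normalized_bound R `|x| `|y| `|z| (b / a) (c / a).
move: key ab bc; rewrite bE cE !normr_ge0 x1 y1 z1 !real_normK ?num_real //.
rewrite !mulfK //; set s := b / a; set t := c / a => key ab bc h.
have {}h : 12 * (s + x ^+ 2) * (t + z ^+ 2 * s + y ^+ 2) <= 25 * s * t.
  by apply: h => //; rewrite -(ler_pM2r a0); lra.
have : 0 <= a ^+ 2 * (25 * s * t - 12 * (s + x ^+ 2) * (t + z ^+ 2 * s + y ^+ 2)).
  by rewrite mulr_ge0 ?sqr_ge0 // subr_ge0.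
lra.
Qed.

(** * Inner products, and lattices and HKZ reduction in ranks one to three *)

Section Lattices.
Context {R : realType} {m : nat}.
Implicit Types u v w a b c g h : 'rV[R]_m.

Lemma dotDl u v w : dot (u + v) w = dot u w + dot v w.
Proof. by rewrite /dot -big_split; apply: eq_bigr => i _; rewrite mxE mulrDl. Qed.

Lemma dotZl (t : R) u v : dot (t *: u) v = t * dot u v.
Proof. by rewrite /dot mulr_sumr; apply: eq_bigr => i _; rewrite mxE mulrA. Qed.

Lemma dotDr u v w : dot w (u + v) = dot w u + dot w v.
Proof. by rewrite dotC dotDl !(dotC w). Qed.

Lemma dotZr (t : R) u v : dot v (t *: u) = t * dot v u.
Proof. by rewrite dotC dotZl (dotC v). Qed.

Lemma dot_ge0 u : 0 <= dot u u.
Proof. by rewrite -enorm_sqr sqr_ge0. Qed.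

Lemma dot_eq0 u : (dot u u == 0) = (u == 0).
Proof.
apply/eqP/eqP => [u0|->]; last by rewrite /dot big1 // => i _; rewrite mxE mul0r.
apply/rowP => i; rewrite mxE; apply/eqP; rewrite -sqrf_eq0 expr2.
by apply/eqP; apply: (psumr_eq0P _ u0) => // j _; rewrite -expr2 sqr_ge0.
Qed.

Lemma dot_gt0 u : (0 < dot u u) = (u != 0).
Proof. by rewrite lt0r dot_ge0 andbT dot_eq0. Qed.

Lemma ler_enorm u v : (enorm u <= enorm v) = (dot u u <= dot v v).
Proof. by rewrite ler_sqrt ?dot_ge0. Qed.

Lemma dot_gs_step u v : dot (u - gs_coef u v *: v) v = 0.
Proof. by rewrite dotBZl gs_coefK subrr. Qed.

Lemma gs_coefD_orth u v (t : R) :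
  v != 0 -> dot u v = 0 -> gs_coef (u + t *: v) v = t.
Proof.
rewrite -dot_gt0 => v0 uv.
by rewrite /gs_coef enorm_sqr dotDl dotZl uv add0r mulfK // gt_eqF.
Qed.

Lemma dot_orth a g h (p q r : R) : dot g a = 0 -> dot h a = 0 -> dot h g = 0 ->
  dot (p *: a + q *: g + r *: h) (p *: a + q *: g + r *: h) =
  p ^+ 2 * dot a a + q ^+ 2 * dot g g + r ^+ 2 * dot h h.
Proof.
move=> ga ha hg; rewrite !(dotDl, dotDr, dotZl, dotZr) ga ha hg.
rewrite (dotC a g) (dotC a h) (dotC g h) ga ha hg; ring.
Qed.

Lemma lattice1P a v : lattice [tuple a] v <-> exists p : int, v = p%:~R *: a.
Proof.
split=> [[x ->]|[p ->]].
  by exists (x ord0); rewrite big_ord_recl big_ord0 addr0.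
by exists (fun=> p); rewrite big_ord_recl big_ord0 addr0.
Qed.

Lemma lattice2P a b v :
  lattice [tuple a; b] v <-> exists p q : int, v = p%:~R *: a + q%:~R *: b.
Proof.
split=> [[x ->]|[p [q ->]]].
  exists (x ord0), (x (lift ord0 ord0)).
  by rewrite !big_ord_recl big_ord0 addr0.
exists (fun i => [:: p; q]`_i).
by rewrite !big_ord_recl big_ord0 addr0.
Qed.

Lemma lattice3P a b c v :
  lattice [tuple a; b; c] v <->
  exists p q r : int, v = p%:~R *: a + q%:~R *: b + r%:~R *: c.
Proof.
split=> [[x ->]|[p [q [r ->]]]].
  exists (x ord0), (x (lift ord0 ord0)), (x (lift ord0 (lift ord0 ord0))).
  by rewrite !big_ord_recl big_ord0 addr0 addrA.
exists (fun i => [:: p; q; r]`_i).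
by rewrite !big_ord_recl big_ord0 addr0 addrA.
Qed.

Lemma shortest_nonzero_le (L : set 'rV[R]_m) v w :
  shortest_nonzero L v -> L w -> 0 < dot w w -> dot v v <= dot w w.
Proof. by move=> [_ _ min_v] Lw; rewrite dot_gt0 -ler_enorm; apply: min_v. Qed.

Lemma HKZ_reduced1P a : HKZ_reduced [tuple a] <-> a != 0.
Proof.
split=> [[_ [_ + _] _]|a0]; first by rewrite theadE.
split=> //; first by move=> [[]] // ? [[]].
rewrite theadE; split=> //.
  by apply/lattice1P; exists 1; rewrite scale1r.
move=> w /lattice1P[p ->]; rewrite scaler_eq0 negb_or intr_eq0 => /andP[p0 _].
rewrite ler_enorm dotZl dotZr mulrA -[X in X <= _]mul1r.
rewrite ler_wpM2r ?dot_ge0 // -expr2 -rmorphXn /= (ler_int _ 1).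
by rewrite -gtz0_ge1 exprn_even_gt0.
Qed.

Lemma HKZ_reduced2P a b :
  HKZ_reduced [tuple a; b] <->
  [/\ `|gs_coef b a| <= 1 / 2, shortest_nonzero (lattice [tuple a; b]) a
    & b - gs_coef b a *: a != 0].
Proof.
have tailE : [tuple gs_proj [tuple a; b] 1 i.+1 | i < 1] =
    [tuple b - gs_coef b a *: a].
  by apply: eq_from_tnth => -[[|//] i1]; rewrite tnth_mktuple.
split=> [[mu sh]|[mu sh g0]].
  rewrite tailE => /HKZ_reduced1P ?; split=> //.
  exact: (mu (lift ord0 ord0) ord0).
split=> //; last by rewrite tailE; apply/HKZ_reduced1P.
by move=> [[|[|//]] i2] [[|[|//]] j2].
Qed.

Lemma HKZ_reduced3P a b c
    (g := b - gs_coef b a *: a) (h := c - gs_coef c a *: a) :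
  HKZ_reduced [tuple a; b; c] <->
  [/\ [/\ `|gs_coef b a| <= 1 / 2, `|gs_coef c a| <= 1 / 2
       & `|gs_coef c g| <= 1 / 2],
    shortest_nonzero (lattice [tuple a; b; c]) a & HKZ_reduced [tuple g; h]].
Proof.
have tailE : [tuple gs_proj [tuple a; b; c] 1 i.+1 | i < 2] = [tuple g; h].
  by apply: eq_from_tnth => -[[|[|//]] i1]; rewrite tnth_mktuple.
split=> [[mu sh]|[[mu1 mu2 mu3] sh gh]].
  rewrite tailE => gh; split=> //; split.
  - exact: (mu (lift ord0 ord0) ord0).
  - exact: (mu (lift ord0 (lift ord0 ord0)) ord0).
  - exact: (mu (lift ord0 (lift ord0 ord0)) (lift ord0 ord0)).
split=> //; last by rewrite tailE.
by move=> [[|[|[|//]]] i2] [[|[|[|//]]] j2].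
Qed.

Lemma orth_defect1E a : orth_defect [tuple a] = dot a a / dot a a.
Proof.
rewrite /orth_defect /det2 !big_ord_recl !big_ord0 !mulr1 !enorm_sqr.
exact: erefl.
Qed.

Lemma orth_defect2E a b (g := b - gs_coef b a *: a) :
  orth_defect [tuple a; b] = dot a a * dot b b / (dot a a * dot g g).
Proof.
rewrite /orth_defect /det2 !big_ord_recl !big_ord0 !mulr1 !enorm_sqr.
exact: erefl.
Qed.

Lemma orth_defect3E a b c
    (g := b - gs_coef b a *: a) (k := c - gs_coef c a *: a - gs_coef c g *: g) :
  orth_defect [tuple a; b; c] =
  dot a a * dot b b * dot c c / (dot a a * dot g g * dot k k).
Proof.
rewrite /orth_defect /det2 !big_ord_recl !big_ord0 !mulr1 !enorm_sqr !mulrA.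
exact: erefl.
Qed.

(** * Upper bounds on the defect *)

(** With [g] the projection of [b], the defect is [1 + x ^+ 2 * dot a a / dot g g]. Minimality of
    [a] and [x ^+ 2 <= 1 / 4] give [dot g g >= 3 / 4 * dot a a]. *)
Lemma orth_defect2_le a b : HKZ_reduced [tuple a; b] ->
  orth_defect [tuple a; b] <= 4 / 3.
Proof.
move/HKZ_reduced2P; rewrite orth_defect2E; set x := gs_coef b a.
move=> [x1 sh g0]; set g := b - x *: a in g0 *.
have ga : dot g a = 0 by exact: dot_gs_step.
have bE : b = g + x *: a by rewrite subrK.
clearbody g.
have bb : dot b b = dot g g + x ^+ 2 * dot a a.
  by rewrite bE !(dotDl, dotDr, dotZl, dotZr) (dotC a g) ga; ring.
have G0 : 0 < dot g g by rewrite dot_gt0.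
have A0 : 0 < dot a a by case: sh => _ + _; rewrite dot_gt0.
have ab : dot a a <= dot b b.
  apply: (shortest_nonzero_le _ _ _ sh).
    by apply/lattice2P; exists 0, 1; rewrite scale0r add0r scale1r.
  by rewrite bb ltr_pwDl // mulr_ge0 ?sqr_ge0 ?dot_ge0.
have x2 : x ^+ 2 <= 1 / 4.
  by rewrite -real_normK ?num_real //; move: x1 (normr_ge0 x); nra.
rewrite ler_pdivrMr ?mulr_gt0 // bb; move: ab; rewrite bb => ab.
have : 0 <= dot a a * (dot g g / 3 - x ^+ 2 * dot a a).
  by rewrite mulr_ge0 ?dot_ge0 //; nra.
lra.
Qed.

(** In the orthogonal frame [a], [g], [k] all norms are sums of squares, and the hypotheses of
    [rank3_bound] are minimality of [a] against [b] and [p a + q b + c], and of [g] against [h]. *)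
Lemma orth_defect3_le a b c : HKZ_reduced [tuple a; b; c] ->
  orth_defect [tuple a; b; c] <= 25 / 12.
Proof.
move/HKZ_reduced3P; rewrite orth_defect3E.
set x := gs_coef b a; set y := gs_coef c a; set g := b - x *: a.
set h := c - y *: a; set z := gs_coef c g; set k := h - z *: g.
move=> [[x1 y1 z1] sh /HKZ_reduced2P[_ sh2]].
have ga : dot g a = 0 by exact: dot_gs_step.
(* Since [g] is orthogonal to [a], projecting [c] to [h] does not change its coefficient along
   [g]. *)
have hg : dot h g = dot c g by rewrite dotBZl (dotC a) ga mulr0 subr0.
have -> : gs_coef h g = z by rewrite /z /gs_coef hg.
rewrite -/k => k0.
have kg : dot k g = 0 by rewrite dotBZl hg gs_coefK subrr.
have ka : dot k a = 0 by rewrite dotBZl ga mulr0 subr0; exact: dot_gs_step.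
have bE : b = x *: a + g by rewrite addrC subrK.
have hE : h = z *: g + k by rewrite addrC subrK.
have cE : c = y *: a + z *: g + k by rewrite -addrA -hE addrC subrK.
have A0 : 0 < dot a a by case: sh => _ + _; rewrite dot_gt0.
have G0 : 0 < dot g g by case: sh2 => _ + _; rewrite dot_gt0.
have K0 : 0 < dot k k by rewrite dot_gt0.
have bb : dot b b = dot g g + x ^+ 2 * dot a a.
  have := dot_orth a g k x 1 0 ga ka kg.
  by rewrite scale1r scale0r addr0 -bE => ->; ring.
have cc : dot c c = dot k k + z ^+ 2 * dot g g + y ^+ 2 * dot a a.
  by have := dot_orth a g k y z 1 ga ka kg; rewrite scale1r -cE => ->; ring.
have hh : dot h h = z ^+ 2 * dot g g + dot k k.
  have := dot_orth a g k 0 z 1 ga ka kg.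
  by rewrite scale1r scale0r add0r -hE => ->; ring.
rewrite ler_pdivrMr ?mulr_gt0 // bb cc.
suff : 12 * (dot g g + x ^+ 2 * dot a a) *
    (dot k k + z ^+ 2 * dot g g + y ^+ 2 * dot a a) <= 25 * dot g g * dot k k.
  by rewrite -(ler_pM2r A0); lra.
apply: rank3_bound => //.
- suff : dot a a <= dot b b by rewrite bb addrC.
  apply: (shortest_nonzero_le _ _ _ sh).
    by apply/lattice3P; exists 0, 1, 0; rewrite !scale0r add0r scale1r addr0.
  by rewrite bb ltr_pwDl // mulr_ge0 ?sqr_ge0 ?dot_ge0.
- rewrite -hh; apply: (shortest_nonzero_le _ _ _ sh2).
    by apply/lattice2P; exists 0, 1; rewrite !scale0r add0r scale1r.
  by rewrite hh ltr_wpDl // mulr_ge0 ?sqr_ge0 ?dot_ge0.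
move=> p q.
(* These are the coordinates of [p a + q b + c] in the frame; the vector is nonzero because its [k]
   coordinate is 1. *)
have wE := dot_orth a g k (y + q%:~R * x + p%:~R) (z + q%:~R) 1 ga ka kg.
rewrite expr1n mul1r in wE; rewrite -wE; apply: (shortest_nonzero_le _ _ _ sh).
  apply/lattice3P; exists p, q, 1.
  rewrite [in q%:~R *: b]bE [in RHS]cE mulr1z !scalerDr !scalerDl !scale1r !scalerA.
  by apply/rowP => i; rewrite !mxE; ring.
by rewrite wE ltr_wpDl // addr_ge0 // mulr_ge0 ?sqr_ge0 ?dot_ge0.
Qed.

End Lattices.

(** * Bases attaining the bounds *)

(** The norm form of the hexagonal lattice is positive definite and integer valued. *)
Lemma eisenstein_form_ge1 (R : numDomainType) (p q : int) :
  (p, q) != (0, 0) -> 1 <= (p%:~R ^+ 2 + p%:~R * q%:~R + q%:~R ^+ 2 : R).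
Proof.
rewrite xpair_eqE negb_and => pq.
rewrite -!rmorphXn -rmorphM -!rmorphD /= (ler_int _ 1); nia.
Qed.

Lemma sqr_le0_eq0 (R : realDomainType) (x : R) : x ^+ 2 <= 0 -> x = 0.
Proof. by move=> x2; apply/eqP; rewrite -sqrf_eq0 eq_le x2 sqr_ge0. Qed.

Section Extremal.
Context {R : realType} {m : nat}.
Variables a g h : 'rV[R]_m.
Hypotheses (aa : dot a a = 4) (gg : dot g g = 4) (hh : dot h h = 3).
Hypotheses (ga : dot g a = 0) (ha : dot h a = 0) (hg : dot h g = 0).

Let b := g + (1 / 2) *: a.
Let h2 := h + (1 / 2) *: g.
Let c := h2 + (1 / 2) *: a.

Let nz_norm (v : 'rV[R]_m) n : dot v v = n.+1%:R -> v != 0.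
Proof. by rewrite -dot_gt0 => ->; rewrite ltr0Sn. Qed.

Let a0 : a != 0 := nz_norm _ _ aa.
Let g0 : g != 0 := nz_norm _ _ gg.
Let h0 : h != 0 := nz_norm _ _ hh.

Let half_norm : `|1 / 2 : R| <= 1 / 2.
Proof. by rewrite ger0_norm // divr_ge0. Qed.

Let h2a : dot h2 a = 0.
Proof. by rewrite dotDl dotZl ga ha mulr0 addr0. Qed.

Let mucg : gs_coef c g = 1 / 2.
Proof.
rewrite /c /h2 addrAC gs_coefD_orth //.
by rewrite dotDl dotZl hg (dotC a) ga mulr0 addr0.
Qed.

Let hex_combE (p q : R) : p *: g + q *: h2 = 0 *: a + (p + q / 2) *: g + q *: h.
Proof. by apply/rowP => i; rewrite !mxE; field. Qed.

Let ext_combE (p q r : R) :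
  p *: a + q *: b + r *: c = (p + q / 2 + r / 2) *: a + (q + r / 2) *: g + r *: h.
Proof. by apply/rowP => i; rewrite !mxE; field. Qed.

Let dot_hex_comb (p q : R) :
  dot (p *: g + q *: h2) (p *: g + q *: h2) = 4 * (p ^+ 2 + p * q + q ^+ 2).
Proof. by rewrite hex_combE dot_orth // aa gg hh; field. Qed.

Let dot_ext_comb (p q r : R) :
  dot (p *: a + q *: b + r *: c) (p *: a + q *: b + r *: c) =
  (2 * p + q + r) ^+ 2 + 4 * (q ^+ 2 + q * r + r ^+ 2).
Proof. by rewrite ext_combE dot_orth // aa gg hh; field. Qed.

Lemma free_hexagonal : free [tuple g; h2].
Proof.
apply/freeP => k; rewrite !big_ord_recl big_ord0 addr0 /=.
set p := k _; set q := k _ => pq0.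
have := dot_hex_comb p q; rewrite pq0 (eqP (_ : dot 0 0 == 0)) ?dot_eq0 // => E.
(* Four times the form is [(2 * p + q) ^+ 2 + 3 * q ^+ 2]. *)
have q0 : q = 0 by apply: sqr_le0_eq0; have := sqr_ge0 (2 * p + q); nra.
have p0 : p = 0 by apply: sqr_le0_eq0; move: E; rewrite q0; nra.
move=> [[|[|//]] i2].
- by rewrite -[RHS]p0; congr k; apply: val_inj.
- by rewrite -[RHS]q0; congr k; apply: val_inj.
Qed.

Lemma HKZ_hexagonal : HKZ_reduced [tuple g; h2].
Proof.
have mu : gs_coef h2 g = 1 / 2 by rewrite gs_coefD_orth.
apply/HKZ_reduced2P; rewrite mu addrK; split=> //; split=> //.
  by apply/lattice2P; exists 1, 0; rewrite scale1r scale0r addr0.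
move=> w /lattice2P[p [q ->]]; have [[-> ->]|pq _] := eqVneq (p, q) (0, 0).
  by rewrite !scale0r addr0 eqxx.
by rewrite ler_enorm dot_hex_comb gg ler_peMr // eisenstein_form_ge1.
Qed.

Lemma orth_defect_hexagonal : orth_defect [tuple g; h2] = 4 / 3.
Proof.
have h2h2 : dot h2 h2 = 4.
  by have := dot_hex_comb 0 1; rewrite scale0r add0r scale1r => ->; ring.
by rewrite orth_defect2E gs_coefD_orth // addrK gg hh h2h2; field.
Qed.

Lemma free_extremal3 : free [tuple a; b; c].
Proof.
apply/freeP => k; rewrite !big_ord_recl big_ord0 addr0 addrA /=.
set p := k _; set q := k _; set r := k _ => pqr0.
have := dot_ext_comb p q r; rewrite pqr0 (eqP (_ : dot 0 0 == 0)) ?dot_eq0 // => E.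
(* The squared norm is [(2 * p + q + r) ^+ 2 + (2 * q + r) ^+ 2 + 3 * r ^+ 2]. *)
have r0 : r = 0.
  apply: sqr_le0_eq0.
  by have := sqr_ge0 (2 * p + q + r); have := sqr_ge0 (2 * q + r); nra.
have q0 : q = 0.
  by apply: sqr_le0_eq0; have := sqr_ge0 (2 * p + q); move: E; rewrite r0; nra.
have p0 : p = 0 by apply: sqr_le0_eq0; move: E; rewrite r0 q0; nra.
move=> [[|[|[|//]]] i3].
- by rewrite -[RHS]p0; congr k; apply: val_inj.
- by rewrite -[RHS]q0; congr k; apply: val_inj.
- by rewrite -[RHS]r0; congr k; apply: val_inj.
Qed.

(** Projecting away [a] leaves the hexagonal basis. A lattice vector outside the line of [a] already
    has projected squared norm at least 4, and on that line it is a nonzero integer multiple of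
    [a]. *)
Lemma HKZ_extremal3 : HKZ_reduced [tuple a; b; c].
Proof.
have muba : gs_coef b a = 1 / 2 by rewrite gs_coefD_orth.
have muca : gs_coef c a = 1 / 2 by rewrite gs_coefD_orth.
apply/HKZ_reduced3P; rewrite muba muca !addrK mucg.
split=> //; last exact: HKZ_hexagonal.
split=> //.
  by apply/lattice3P; exists 1, 0, 0; rewrite scale1r !scale0r !addr0.
move=> w /lattice3P[p [q [r ->]]] w0.
rewrite ler_enorm dot_ext_comb aa.
have [[q0 r0]|qr] := eqVneq (q, r) (0, 0).
  move: w0; rewrite q0 r0 !scale0r !addr0 scaler_eq0 intr_eq0 => /norP[p0 _].
  have p1 : 1 <= p%:~R ^+ 2 :> R.
    by rewrite -rmorphXn /= (ler_int _ 1) -gtz0_ge1 exprn_even_gt0.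
  lra.
have := @eisenstein_form_ge1 R q r qr.
have := sqr_ge0 (2 * p%:~R + q%:~R + r%:~R : R).
lra.
Qed.

(** The squared norms are 4, 5, 5 and the Gram determinant is 4 * 4 * 3. *)
Lemma orth_defect_extremal3 : orth_defect [tuple a; b; c] = 25 / 12.
Proof.
have bb : dot b b = 5.
  by have := dot_ext_comb 0 1 0; rewrite !scale0r add0r scale1r addr0 => ->; ring.
have cc : dot c c = 5.
  by have := dot_ext_comb 0 0 1; rewrite !scale0r !add0r scale1r => ->; ring.
rewrite orth_defect3E gs_coefD_orth // addrK gs_coefD_orth // addrK.
by rewrite mucg addrK aa gg hh bb cc; field.
Qed.

End Extremal.

Theorem theorem2 (R : realType) :
  is_max (HKZ_defects R 1) 1 /\
  is_max (HKZ_defects R 2) (4 / 3) /\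
  is_max (HKZ_defects R 3) (25 / 12).
Proof.
(* Five coordinates allow squared norm 3 to be realized as 1 + 1 + 1 without square roots. Short
   sequences are padded by the default value 0. *)
pose vec (s : seq R) : 'rV[R]_5 := \row_i s`_i.
pose a := vec [:: 2]; pose g := vec [:: 0; 2]; pose h := vec [:: 0; 0; 1; 1; 1].
have dot_vec s t : dot (vec s) (vec t) = \sum_(i < 5) s`_i * t`_i.
  by apply: eq_bigr => i _; rewrite !mxE.
have aa : dot a a = 4 by rewrite dot_vec !big_ord_recl big_ord0 /=; ring.
have gg : dot g g = 4 by rewrite dot_vec !big_ord_recl big_ord0 /=; ring.
have hh : dot h h = 3 by rewrite dot_vec !big_ord_recl big_ord0 /=; ring.
have ga : dot g a = 0 by rewrite dot_vec !big_ord_recl big_ord0 /=; ring.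
have ha : dot h a = 0 by rewrite dot_vec !big_ord_recl big_ord0 /=; ring.
have hg : dot h g = 0 by rewrite dot_vec !big_ord_recl big_ord0 /=; ring.
have a0 : a != 0 by rewrite -dot_gt0 aa.
split; [|split]; split.
- exists 5, [tuple a]; split=> //; first by rewrite seq1_free.
    exact/HKZ_reduced1P.
  by rewrite orth_defect1E divff ?dot_eq0.
- move=> _ [m [B [_ _ + ->]]].
  case: B => [[|u []] sB] //.
  rewrite (_ : Tuple sB = [tuple u]); last exact: val_inj.
  by move=> /HKZ_reduced1P u0; rewrite orth_defect1E divff ?dot_eq0.
- exists 5, [tuple g; h + (1 / 2) *: g]; split=> //.
  + exact: free_hexagonal aa gg hh ga ha hg.
  + exact: HKZ_hexagonal aa gg hh ga ha hg.
  + by rewrite (orth_defect_hexagonal _ _ _ aa gg hh ga ha hg).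
- move=> _ [m [B [_ _ + ->]]].
  case: B => [[|u [|v []]] sB] //.
  rewrite (_ : Tuple sB = [tuple u; v]); last exact: val_inj.
  exact: orth_defect2_le.
- exists 5, [tuple a; g + (1 / 2) *: a; h + (1 / 2) *: g + (1 / 2) *: a].
  split=> //.
  + exact: free_extremal3 aa gg hh ga ha hg.
  + exact: HKZ_extremal3 aa gg hh ga ha hg.
  + by rewrite (orth_defect_extremal3 _ _ _ aa gg hh ga ha hg).
- move=> _ [m [B [_ _ + ->]]].
  case: B => [[|u [|v [|w []]]] sB] //.
  rewrite (_ : Tuple sB = [tuple u; v; w]); last exact: val_inj.
  exact: orth_defect3_le.
Qed.
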